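(* Let $q_1,\ldots,q_n$ be a positive elliptic-elliptic rotopulsator solution, with masses $m_1,\ldots,m_n>0$, of the curved $n$-body problem on $\mathbb{S}^3$, and suppose that $r_i=r$ and $\rho_i=\rho$ are independent of $i$ and not constant. If the $\alpha_i$, $i\in\{1,\ldots,n\}$, are all distinct and the $\beta_i$, $i\in\{1,\ldots,n\}$, are all distinct (as angles modulo $2\pi$), then at least one of the following holds: (a) the configuration of the vectors $(q_{i1},q_{i2})^T$, $i\in\{1,\ldots,n\}$, and the configuration of the vectors $(q_{i3},q_{i4})^T$, $i\in\{1,\ldots,n\}$, are regular polygons with $n$ vertices, and all masses are equal; or (b) the $q_i$, $i\in\{1,\ldots,n\}$, represent the vertices of a (not necessarily regular) polygon inscribed in a great circle of $\mathbb{S}^3$.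
   Context: Curved $n$-body problem on $\mathbb{S}^3=\{x\in\mathbb{R}^4\mid x_1^2+x_2^2+x_3^2+x_4^2=1\}$ (the case of curvature sign $\sigma=1$): find functions $q_1,\ldots,q_n$ of time with values in $\mathbb{S}^3$, with masses $m_1,\ldots,m_n>0$, solving $$\ddot q_i=\sum_{j=1,\,j\neq i}^{n}\frac{m_j\,(q_j-\langle q_i,q_j\rangle q_i)}{(1-\langle q_i,q_j\rangle^2)^{3/2}}-\langle\dot q_i,\dot q_i\rangle q_i,\qquad i\in\{1,\ldots,n\},$$ where $\langle\cdot,\cdot\rangle$ is the Euclidean inner product on $\mathbb{R}^4$. For a solution the right-hand side has to be defined, i.e. $\langle q_i,q_j\rangle^2\neq 1$ for $i\neq j$. Positive elliptic-elliptic rotopulsator: a solution $q_1,\ldots,q_n$ of this system, $q_i=(q_{i1},q_{i2},q_{i3},q_{i4})^T$, for which there exist nonnegative scalar functions of time $r_i,\rho_i$ with $r_i^2+\rho_i^2=1$, scalar functions of time $\theta,\phi$ (not depending on $i$) and constants $\alpha_i,\beta_i\in\mathbb{R}$ such that $$\begin{pmatrix} q_{i1} \\ q_{i2} \end{pmatrix}=r_i\begin{pmatrix}\cos(\theta+\alpha_i)\\ \sin(\theta+\alpha_i)\end{pmatrix},\qquad \begin{pmatrix} q_{i3} \\ q_{i4} \end{pmatrix}=\rho_i\begin{pmatrix}\cos(\phi+\beta_i)\\ \sin(\phi+\beta_i)\end{pmatrix},\qquad i\in\{1,\ldots,n\}$$ (the $\alpha_i$ are not required to be all the same value, and likewise for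 the $\beta_i$). A great circle of $\mathbb{S}^3$ is the intersection of $\mathbb{S}^3$ with a 2-dimensional linear subspace of $\mathbb{R}^4$ (which may depend on time here). Vectors on a circle centred at the origin of $\mathbb{R}^2$ form a regular polygon with $n$ vertices if they are $n$ distinct points equally spaced on that circle.
   Formalization: In (a), the vectors (q_i1,q_i2) are claimed to form a regular polygon only at times when r is nonzero, and (q_i3,q_i4) only when rho is nonzero; since theta and phi need not be continuous, r or rho can vanish at isolated times, when the vectors all coincide at the origin. *)

(* Defs.v *)
From HB Require Import structures.
From mathcomp Require Import all_boot all_order all_algebra all_fingroup.
From mathcomp Require Import all_classical all_reals all_analysis.
Set Implicit Arguments.
Unset Strict Implicit.
Unset Printing Implicit Defensive.
Import Order.TTheory GRing.Theory Num.Theory.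
Import numFieldNormedType.Exports.
Local Open Scope classical_set_scope.
Local Open Scope ring_scope.

Section CurvedNBody.
Variable R : realType.

Definition dot k (u v : 'rV[R]_k) : R := \sum_(l < k) u 0 l * v 0 l.

Definition sphere3 : set 'rV[R]_4 := [set x | dot x x = 1].

(* Curved n-body problem with curvature sign 1, on the time domain I.  The
   condition on the pairwise inner products says that the right-hand side is
   defined; on the sphere it makes the base of the power positive. *)
Definition curved_nbody_solution n (m : 'I_n -> R) (I : set R)
    (q : 'I_n -> R -> 'rV[R]_4) : Prop :=
  forall t, I t -> forall i,
    [/\ sphere3 (q i t),
        forall j, j != i -> dot (q i t) (q j t) ^+ 2 != 1,
        derivable (q i) t 1,
        derivable (derive1 (q i)) t 1
      & derive1n 2 (q i) t =
          \sum_(j < n | j != i)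
             (m j / (1 - dot (q i t) (q j t) ^+ 2) `^ (3 / 2))
               *: (q j t - dot (q i t) (q j t) *: q i t)
          - dot (derive1 (q i) t) (derive1 (q i) t) *: q i t].

(* (q_i1, q_i2) and (q_i3, q_i4); coordinates are numbered from 0 here. *)
Definition coords12 (x : 'rV[R]_4) : 'rV[R]_2 := lsubmx (x : 'rV[R]_(2 + 2)).
Definition coords34 (x : 'rV[R]_4) : 'rV[R]_2 := rsubmx (x : 'rV[R]_(2 + 2)).

Definition unit_vec (a : R) : 'rV[R]_2 :=
  \row_(k < 2) (if k == 0 then cos a else sin a).

(* No regularity is required of r, rho, theta, phi. *)
Definition positive_elliptic_elliptic n (m : 'I_n -> R) (I : set R)
    (q : 'I_n -> R -> 'rV[R]_4) (r rho : 'I_n -> R -> R)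
    (theta phi : R -> R) (alpha beta : 'I_n -> R) : Prop :=
  curved_nbody_solution m I q /\
  forall t, I t -> forall i,
    [/\ 0 <= r i t, 0 <= rho i t, r i t ^+ 2 + rho i t ^+ 2 = 1,
        coords12 (q i t) = r i t *: unit_vec (theta t + alpha i)
      & coords34 (q i t) = rho i t *: unit_vec (phi t + beta i)].

Definition constant_on (I : set R) (f : R -> R) : Prop :=
  exists c, forall t, I t -> f t = c.

Definition eq_angle (a b : R) : Prop := exists k : int, a - b = k%:~R * (2 * pi).

Definition distinct_angles n (a : 'I_n -> R) : Prop :=
  forall i j, eq_angle (a i) (a j) -> i = j.

(* The permutation s lists the points in cyclic order; since c > 0 and s is a
   permutation, the n points are distinct. *)
Definition regular_polygon n (p : 'I_n -> 'rV[R]_2) : Prop :=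
  exists (c w : R) (s : 'S_n), 0 < c /\
    forall k : 'I_n, p (s k) = c *: unit_vec (w + 2 * pi * k%:R / n%:R).

Definition great_circle (C : set 'rV[R]_4) : Prop :=
  exists W : {vspace 'rV[R]_4},
    \dim W = 2 /\ C = sphere3 `&` [set x | x \in W].

Definition polygon_in_great_circle n (p : 'I_n -> 'rV[R]_4) : Prop :=
  injective p /\ exists C, great_circle C /\ forall i, C (p i).

End CurvedNBody.

(* Main.v *)
Require Import Defs.
From HB Require Import structures.
From mathcomp Require Import all_boot all_order all_algebra all_fingroup.
From mathcomp Require Import all_classical all_reals all_analysis.
From mathcomp Require Import ring lra zify.
Set Implicit Arguments.
Unset Strict Implicit.
Unset Printing Implicit Defensive.
Import Order.TTheory GRing.Theory Num.Theory.
Import numFieldNormedType.Exports.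
Local Open Scope classical_set_scope.
Local Open Scope ring_scope.

(* Let s = r^2.  The inner product of q_i and q_j is c_ij = y + (x - y) s with
   x = cos (alpha_j - alpha_i), y = cos (beta_j - beta_i).  Since every q_i is
   obtained from every other by a constant rotation, comparing the equations of
   motion gives, with D_ij = 1 - c_ij^2, that
     sum_j m_j D_ij^(-3/2) sin (alpha_j - alpha_i) = 0, likewise for beta, and
     sum_j m_j D_ij^(-3/2) (x - y) does not depend on i,
   for all s in an open interval.  The functions D^(-3/2) belonging to distinct
   nonconstant polynomials D are linearly independent, so each of these sums
   splits according to the value of {(x, y), (-x, -y)}.
   Consider i, j with x <> y and view P_i = (alpha_i, beta_i) as points of the
   torus.  The split sums force P_i - (P_j - P_i) to be one of the points, with
   the mass of P_j; iterating this, d = P_j - P_i has finite order, which is odd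
   because no two points are antipodal.  The third sum then shows that every
   point has a neighbour with the same (x, y), so that the angles alpha are
   permuted by the translations alpha_j - alpha_i, first for x <> y and then for
   all i, j; likewise for beta.  Hence both sets of angles are cosets of the
   group of n-th roots of unity and the masses are equal.
   If x = y for all i, j, then the Gram matrix of the q_i is the one of the
   planar vectors (cos alpha_i, sin alpha_i), so the q_i lie in a plane. *)

(** * Linear independence of the functions [D `^ (- (3 / 2))] *)

Section RadicalIndependence.
Variable R : realType.
Implicit Types (p D E : {poly R}) (e s u x : R) (L : seq ({poly R} * {poly R})).

Lemma poly_eq0_itv p a b : a < b -> (forall s, a < s < b -> p.[s] = 0) -> p = 0.
Proof.
move=> ab p0; apply/eqP; apply: contraT => pn0.
pose x (k : nat) := a + (b - a) / (k.+2)%:R.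
have xI k : a < x k < b.
  have k0 : 0 < (k.+2)%:R :> R by rewrite ltr0n.
  rewrite /x ltrDl divr_gt0 ?subr_gt0//= -ltrBrDl ltr_pdivrMr// ltr_pMr ?subr_gt0//.
  by rewrite ltr1n.
have xinj : injective x.
  move=> i j /addrI /(mulfI _) => /(_ _)/invr_inj.
  rewrite subr_eq0 gt_eqF// => /(_ isT)/eqP.
  by rewrite eqr_nat => /eqP [].
have := @max_poly_roots _ p (map x (iota 0 (size p))) pn0.
rewrite size_map size_iota ltnn map_inj_uniq// iota_uniq => -> //.
by apply/allP => _ /mapP[k _ ->]; apply/rootP/p0.
Qed.

(** The extra factor ['X - u%:P] avoids the exponent [n - 1], so that the case [n = 0] is
    included. *)
Lemma horner_deriv_mul_expXsubC p u (n : nat) :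
  ('X - u%:P) * ((('X - u%:P) ^+ n * p)^`()) =
  ('X - u%:P) ^+ n * (n%:R * p + ('X - u%:P) * p^`()).
Proof.
rewrite derivM deriv_exp derivXsubC mul1r mulrDr; case: n => [|n].
  by rewrite !expr0 mulr0n !mul0r mulr0 !mul1r !add0r.
rewrite -pred_Sn -[_ *+ n.+1]mulr_natl exprS; ring.
Qed.

(* The equation says that [p1 / p2] and [(D / E) `^ e] have the same logarithmic
   derivative; its residues at [u] are the difference of the multiplicities of
   [u] in [p1] and [p2], and [e]. *)
Lemma log_derivative_eq_multiplicity p1 p2 D E u e :
  p1 != 0 -> p2 != 0 -> root D u -> ~~ root D^`() u -> ~~ root E u ->
  E * D * (p2 * p1^`() - p2^`() * p1) =
    e *: (p2 * p1 * (E * D^`() - E^`() * D)) ->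
  exists k l : nat, e = k%:R - l%:R.
Proof.
move=> p10 p20 Du D'u Eu.
have [k [q1 /implyP/(_ p10) q1u ->]] := multiplicity_XsubC p1 u.
have [l [q2 /implyP/(_ p20) q2u ->]] := multiplicity_XsubC p2 u.
have /factor_theorem[F FE] := Du; rewrite FE in D'u *.
move=> H; exists k, l; move: D'u; rewrite derivM derivXsubC mulr1
  /root !hornerE subrr mulr0 add0r => Fu.
pose Y : {poly R} := 'X - u%:P; rewrite -/Y in H.
(* Once the powers of [Y] are cancelled, evaluation at [u] leaves [k - l] and [e] times the same
   nonzero number. *)
have {}H : Y ^+ k * Y ^+ l * (E * F * ((k%:R - l%:R) * q1 * q2 +
    Y * (q2 * q1^`() - q2^`() * q1))) =
   Y ^+ k * Y ^+ l * (e *: (q2 * q1 * (E * (F + Y * F^`()) - E^`() * F * Y))).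
  rewrite -!mul_polyC.
  transitivity (E * F * (q2 * Y ^+ l * (Y * (Y ^+ k * q1)^`())
      - (Y * (Y ^+ l * q2)^`()) * (q1 * Y ^+ k))).
    rewrite /Y !horner_deriv_mul_expXsubC -/Y.
    by move: _^`() _^`() (Y ^+ k) (Y ^+ l) k%:R l%:R => *; ring.
  transitivity (E * (F * Y) * (q2 * Y ^+ l * (q1 * Y ^+ k)^`()
      - (q2 * Y ^+ l)^`() * (q1 * Y ^+ k))).
    rewrite [Y ^+ k * q1]mulrC [Y ^+ l * q2]mulrC.
    by do 2![move: (_^`()) => ?]; move: (Y ^+ k) (Y ^+ l) => *; ring.
  rewrite H -mul_polyC derivM {3}/Y derivXsubC -/Y.
  by move: F^`() E^`() (Y ^+ k) (Y ^+ l) => *; ring.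
have Yn0 n : Y ^+ n != 0 by rewrite expf_neq0// polyXsubC_eq0.
move/(mulfI (mulf_neq0 (Yn0 k) (Yn0 l))) : H => /(congr1 (horner^~ u)).
rewrite /Y -!polyC_natr -polyCB !hornerE subrr !(mul0r, mulr0, addr0, subr0).
move: Fu q1u q2u Eu; rewrite /root => Fu q1u q2u Eu H.
have h : E.[u] * F.[u] * q1.[u] * q2.[u] != 0 by rewrite !mulf_neq0.
apply: (mulIf h); move: k%:R l%:R H => K M /= H.
by apply: etrans (etrans _ (esym H)) _; ring.
Qed.

Definition powterm e (pD : {poly R} * {poly R}) s := pD.1.[s] * pD.2.[s] `^ (- e).

Lemma powR_shift e x : 0 < x -> x `^ (- e) = x `^ (- (e + 1)) * x.
Proof.
move=> x0; rewrite -[X in _ * X]powRr1 ?ltW// -powRD; last first.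
  by rewrite (gt_eqF x0) implybT.
by congr (_ `^ _); ring.
Qed.

(** With the power factored out, the derivative is again a [powterm], of exponent [e + 1]. *)
Lemma is_derive_powterm e pD s : 0 < pD.2.[s] ->
  is_derive s 1 (powterm e pD) (pD.2.[s] `^ (- (e + 1)) *
     (pD.1^`().[s] * pD.2.[s] - e * pD.1.[s] * pD.2^`().[s])).
Proof.
case: pD => p D /= D0.
have dp q : is_derive s 1 (horner q) q^`().[s].
  by split; [exact: derivable_horner|rewrite -derive1E derivE].
have dD : is_derive s (1 : R) ((fun x => x `^ (- e)) \o horner D)
    (D^`().[s] * (- e * D.[s] `^ (- e - 1))).
  have dpow := @is_derive1_powR R (- e) _ D0.
  by have := is_derive1_comp dpow (dp D); rewrite mulrC.
have -> : D.[s] `^ (- (e + 1)) * (p^`().[s] * D.[s] - e * p.[s] * D^`().[s]) =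
  p.[s] *: (D^`().[s] * (- e * D.[s] `^ (- e - 1))) + (D.[s] `^ (- e)) *: p^`().[s].
  by rewrite /GRing.scale /= (powR_shift e D0) -opprD; ring.
exact: (is_deriveM (dp p) dD).
Qed.

Lemma is_derive_sum_powterm e L s : all (fun pD => 0 < pD.2.[s]) L ->
  is_derive s 1 (fun s => \sum_(pD <- L) powterm e pD s)
   (\sum_(pD <- L) pD.2.[s] `^ (- (e + 1)) *
     (pD.1^`().[s] * pD.2.[s] - e * pD.1.[s] * pD.2^`().[s])).
Proof.
elim: L => [_|pD L IH /= /andP[h /IH dL]].
  under [X in is_derive _ _ X _]funext do rewrite big_nil.
  by rewrite big_nil; exact: is_derive_cst.
under [X in is_derive _ _ X _]funext do rewrite big_cons.
by rewrite big_cons; apply: is_deriveD => //; exact: is_derive_powterm.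
Qed.

(* Induction on [L]: if [G] is the sum and [(p2, E)] the head of [L], then
   [p2 E G' + (e p2 E' - p2' E) G] no longer has a term in [E `^ (- e)]; the
   other exponents decrease by 1. *)
Lemma powterm_independent L p D (N : nat) a b : a < b ->
  (forall E, E \in unzip2 L ->
    exists u, [/\ root D u, ~~ root D^`() u & ~~ root E u]) ->
  (forall s, a < s < b -> all (fun pD => 0 < pD.2.[s]) ((p, D) :: L)) ->
  (forall s, a < s < b ->
    \sum_(pD <- (p, D) :: L) powterm (N%:R + 2^-1) pD s = 0) -> p = 0.
Proof.
move=> ab; move: {2}(size L) (erefl (size L)) => n.
elim: n L p N => [|n IH] [|[p2 E] L] p N //.
  move=> _ _ pos H; apply: (poly_eq0_itv ab) => s sab.
  have := H s sab; rewrite big_seq1 /powterm /= => /eqP; rewrite mulf_eq0.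
  have /= /andP[D0 _] := pos s sab.
  by rewrite powR_eq0 (gt_eqF D0) orbF => /eqP.
move=> [sL] DE pos; set e := N%:R + 2^-1 => H.
have [p20|p2n0] := eqVneq p2 0.
  apply: (IH L p N) => // [F FL|s sab|s sab].
    by apply: DE; rewrite inE FL orbT.
    by have /= /andP[-> /andP[_ ->]] := pos s sab.
  by have := H s sab; rewrite !big_cons p20 /powterm /= horner0 mul0r add0r.
apply/eqP; apply: contraT => pn0.
(* The polynomial coefficient of the term [pD] after the elimination, for the exponent [e + 1]; it
   vanishes at [(p2, E)]. *)
pose Q (pD : {poly R} * {poly R}) :=
  p2 * E * (pD.1^`() * pD.2 - e *: (pD.1 * pD.2^`()))
  + (e *: (p2 * E^`()) - p2^`() * E) * (pD.1 * pD.2).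
have Q0 : Q (p, D) = 0.
  apply: (IH [seq (Q pD, pD.2) | pD <- L] _ N.+1).
  - by rewrite size_map.
  - move=> F; rewrite /unzip2 -map_comp => FL.
    by apply: DE; rewrite inE FL orbT.
  - move=> s sab; have /= /andP[-> /andP[_ ]] := pos s sab.
    by rewrite all_map.
  move=> s sab.
  have -> : N.+1%:R + 2^-1 = e + 1 :> R by rewrite /e -natr1; ring.
  have posL : all (fun pD => 0 < pD.2.[s]) [:: (p, D), (p2, E) & L] := pos s sab.
  have dG := is_derive_sum_powterm e posL.
  have G0 : \near s, \sum_(pD <- (p, D) :: (p2, E) :: L) powterm e pD s = cst 0 s.
    near=> t; apply: H; near: t.
    by apply: near_in_itvoo; rewrite in_itv.
  have := near_eq_is_derive G0 dG => -[_]; rewrite derive_cst => /esym dG0.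
  pose S (pD : {poly R} * {poly R}) := p2.[s] * E.[s] *
    (pD.2.[s] `^ (- (e + 1)) *
     (pD.1^`().[s] * pD.2.[s] - e * pD.1.[s] * pD.2^`().[s])) +
    (e * p2.[s] * E^`().[s] - p2^`().[s] * E.[s]) * powterm e pD s.
  have SQ pD : 0 < pD.2.[s] -> S pD = powterm (e + 1) (Q pD, pD.2) s.
    case: pD => p' D' /= D0; rewrite /S /Q /powterm /= !hornerE.
    rewrite (powR_shift e D0) /=; ring.
  have /= /and3P[D0 E0 L0] := pos s sab.
  transitivity (\sum_(pD <- (p, D) :: (p2, E) :: L) S pD); last first.
    by rewrite big_split /= -!mulr_sumr dG0 H// !mulr0 add0r.
  rewrite !big_cons big_map SQ// SQ//.
  have -> : powterm (e + 1) (Q (p2, E), E) s = 0.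
    by rewrite /powterm /Q /= !hornerE /=; ring.
  rewrite add0r; congr (_ + _).
  rewrite big_seq [RHS]big_seq; apply: eq_bigr => pD pDL.
  by rewrite SQ// (allP L0).
(* [Q (p, D) = 0] makes [e] a difference of multiplicities, but [e = N + 1/2]; doubling equates an
   odd number with an even one. *)
have [k [l]] : exists k l : nat, e = k%:R - l%:R.
  have [|u [Du D'u Eu]] := DE E; first by rewrite inE eqxx.
  apply: (@log_derivative_eq_multiplicity p p2 D E u) => //.
  apply/eqP; rewrite -subr_eq0 -Q0 /Q /= -!mul_polyC; apply/eqP; ring.
rewrite /e => h.
have {h} : (N.*2 + 1 + l.*2)%:R = (k.*2)%:R :> R.
  by rewrite !natrD -!mul2n !natrM; lra.
by move/eqP; rewrite eqr_nat; lia.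
Unshelve. all: by end_near. Qed.

(** This is [1 - c ^+ 2] for the inner product [c], as a polynomial in the square of [r]. *)
Definition gap_poly x y : {poly R} := 1 - (y%:P + (x - y) *: 'X) ^+ 2.

Lemma horner_gap_poly x y s :
  (gap_poly x y).[s] = 1 - (y + (x - y) * s) ^+ 2.
Proof. by rewrite /gap_poly !hornerE /= mulrC. Qed.

Lemma gap_polyN x y : gap_poly (- x) (- y) = gap_poly x y.
Proof. by rewrite /gap_poly -opprD scaleNr polyCN -opprD sqrrN. Qed.

Lemma horner_deriv_gap_poly x y s :
  (gap_poly x y)^`().[s] = - ((x - y) * (y + (x - y) * s)) *+ 2.
Proof.
rewrite /gap_poly derivB derivC sub0r expr2 derivM derivD derivC derivZ derivX.
rewrite !hornerE /=; ring.
Qed.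

(* The roots of [gap_poly x y] determine [(x, y)] up to sign. *)
Lemma gap_poly_root_neq x y x' y' : x != y -> (x', y') != (x, y) ->
  (x', y') != (- x, - y) -> gap_poly x' y' != 0 ->
  exists u, [/\ root (gap_poly x y) u, ~~ root (gap_poly x y)^`() u
    & ~~ root (gap_poly x' y') u].
Proof.
move=> xy d1 d2 g0; have xy0 : x - y != 0 by rewrite subr_eq0.
(* The points at which the inner product is 1 and -1. *)
pose u := (1 - y) / (x - y); pose v := (- 1 - y) / (x - y).
have uE : y + (x - y) * u = 1 by rewrite /u; field.
have vE : y + (x - y) * v = - 1 by rewrite /v; field.
have Du : root (gap_poly x y) u.
  by rewrite /root horner_gap_poly uE expr1n subrr.
have Dv : root (gap_poly x y) v.
  by rewrite /root horner_gap_poly vE sqrrN expr1n subrr.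
have D'u : ~~ root (gap_poly x y)^`() u.
  by rewrite /root horner_deriv_gap_poly uE mulr1 mulrn_eq0 oppr_eq0.
have D'v : ~~ root (gap_poly x y)^`() v.
  by rewrite /root horner_deriv_gap_poly vE mulrN1 opprK mulrn_eq0.
have [Eu|Eu] := boolP (root (gap_poly x' y') u); last by exists u.
have [Ev|Ev] := boolP (root (gap_poly x' y') v); last by exists v.
have sq1 s : root (gap_poly x' y') s ->
    y' + (x' - y') * s = 1 \/ y' + (x' - y') * s = - 1.
  rewrite /root horner_gap_poly subr_eq0 eq_sym sqrf_eq1.
  by move=> /orP[/eqP|/eqP]; [left|right].
have uv : u - v = 2 / (x - y) by rewrite /u /v; field.
have uv0 : u - v != 0 by rewrite uv mulf_neq0 ?invr_eq0.
have key c c' : y' + (x' - y') * u = c -> y' + (x' - y') * v = c' ->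
    x' - y' = (c - c') / 2 * (x - y) /\ y' = (c + c') / 2 + (c - c') / 2 * y.
  move=> hu hv.
  have h : (x' - y') * (u - v) = c - c' by rewrite -hu -hv; ring.
  have h2 : x' - y' = (c - c') / 2 * (x - y).
    by rewrite -h uv; field.
  split=> //; have : y' + y' = c + c' - (x' - y') * (u + v).
    by rewrite -hu -hv; ring.
  have -> : u + v = - 2 * y / (x - y) by rewrite /u /v; field.
  rewrite h2 => h3; transitivity ((y' + y') / 2); first by field.
  by rewrite h3; field.
have g1 z : z ^+ 2 = 1 -> gap_poly z z == 0.
  by move=> z2; rewrite /gap_poly subrr scale0r addr0 -rmorphXn /= z2 subrr.
(* Equal values at [u] and [v] make [gap_poly x' y'] zero; opposite ones make [(x', y')] equal to
   [(x, y)] or its negative. *)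
case: (sq1 _ Eu) (sq1 _ Ev) => hu [] hv; have [h1 h2] := key _ _ hu hv.
- case/negP: g0; rewrite (_ : x' = y') ?h2; last by move: h1; lra.
  by rewrite g1 //; lra.
- by case/negP: d1; apply/eqP; congr (_, _); move: h1 h2; lra.
- by case/negP: d2; apply/eqP; congr (_, _); move: h1 h2; lra.
- case/negP: g0; rewrite (_ : x' = y') ?h2; last by move: h1; lra.
  by rewrite g1 //; lra.
Qed.

(** Equality up to a common sign, which [gap_poly] does not see. *)
Definition same_gap (c c' : R * R) := (c' == c) || (c' == (- c.1, - c.2)).

(** The terms in the class of [(x, y)] share one power, with a constant coefficient, which
    [powterm_independent] forces to vanish. *)
Lemma sum_same_gap_eq0 (L : seq (R * (R * R))) x y a b : a < b -> x != y ->
  (forall s, a < s < b ->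
     all (fun w => 0 < 1 - (w.2.2 + (w.2.1 - w.2.2) * s) ^+ 2) L) ->
  (forall s, a < s < b -> \sum_(w <- L)
     w.1 * (1 - (w.2.2 + (w.2.1 - w.2.2) * s) ^+ 2) `^ (- (3 / 2)) = 0) ->
  \sum_(w <- L | same_gap (x, y) w.2) w.1 = 0.
Proof.
move=> ab xy pos H.
have [/hasP[w0 w0L w0c]|nc] := boolP (has (fun w => same_gap (x, y) w.2) L); last first.
  by rewrite big_hasC.
have gapE (w : R * (R * R)) : same_gap (x, y) w.2 -> gap_poly w.2.1 w.2.2 = gap_poly x y.
  by move=> /orP[] /eqP -> //=; rewrite gap_polyN.
apply/eqP; rewrite -polyC_eq0; apply/eqP.
pose L' := [seq (w.1%:P, gap_poly w.2.1 w.2.2) | w <- L & ~~ same_gap (x, y) w.2].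
apply: (@powterm_independent L' _ (gap_poly x y) 1 a b ab).
- move=> E; rewrite /unzip2 -map_comp => /mapP[w].
  rewrite mem_filter negb_or => /andP[/andP[n1 n2] wL] -> /=.
  apply: gap_poly_root_neq => //; try by case: (w.2) n1 n2.
  apply/eqP => g0; have m : a < (a + b) / 2 < b by lra.
  have := allP (pos _ m) w wL.
  by rewrite -horner_gap_poly g0 horner0 ltxx.
- move=> s sab; have ps := pos s sab; apply/allP => pD; rewrite inE.
  move=> /orP[/eqP ->/=|/mapP[w]].
    by rewrite -(gapE _ w0c) horner_gap_poly; exact: (allP ps).
  by rewrite mem_filter => /andP[_ wL] -> /=; rewrite horner_gap_poly (allP ps).
move=> s sab; rewrite -[RHS](H s sab) [RHS](bigID (fun w => same_gap (x, y) w.2)) /=.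
have -> : - (3 / 2) = - (1%:R + 2^-1) :> R by field.
rewrite big_cons big_map big_filter /powterm /=; congr (_ + _).
  rewrite hornerC mulr_suml; apply: eq_bigr => w wc.
  by rewrite -(gapE _ wc) horner_gap_poly.
by apply: eq_bigr => w wc; rewrite hornerC horner_gap_poly.
Qed.

End RadicalIndependence.

(** * Angles modulo [2 pi] *)

Section Angles.
Variable R : realType.
Implicit Types (a b : R) (k n : nat).

Lemma eq_angle_subP a b : eq_angle a b <-> eq_angle (a - b) 0.
Proof. by rewrite /eq_angle subr0. Qed.

Lemma eq_angle00 : eq_angle (0 : R) 0.
Proof. by exists 0; rewrite subrr mul0r. Qed.

Lemma eq_angle0D a b : eq_angle a 0 -> eq_angle b 0 -> eq_angle (a + b) 0.
Proof.
rewrite /eq_angle !subr0 => -[k ->] [l ->]; exists (k + l).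
by rewrite intrD [RHS]mulrDl.
Qed.

Lemma eq_angle0N a : eq_angle a 0 -> eq_angle (- a) 0.
Proof. by rewrite /eq_angle !subr0 => -[k ->]; exists (- k); rewrite rmorphN mulNr. Qed.

Lemma eq_angle0B a b : eq_angle a 0 -> eq_angle b 0 -> eq_angle (a - b) 0.
Proof. by move=> a0 /eq_angle0N; exact: eq_angle0D. Qed.

Lemma eq_angle0Mn a n : eq_angle a 0 -> eq_angle (a *+ n) 0.
Proof.
rewrite /eq_angle !subr0 => -[k ->]; exists (k *+ n).
by rewrite rmorphMn [RHS]mulrnAl.
Qed.

Lemma eq_angle0_cos a : eq_angle a 0 <-> cos a = 1.
Proof.
have per (k : int) b : cos (b + k%:~R * (2 * pi)) = cos b.
  have pern m (c : R) : cos (c + m%:R * (2 * pi)) = cos c.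
    by rewrite !mulr_natl (periodicn (@cosD2pi R)).
  case: k => m; first exact: pern.
  by rewrite NegzE rmorphN mulNr -[LHS](pern m.+1) subrK.
split; first by rewrite /eq_angle subr0 => -[k ->]; rewrite -[X in cos X]add0r per cos0.
(* Injectivity of [cos] is used on [[0, pi]]; an angle beyond [pi] is reflected to [2 * pi - c]. *)
have main (c : R) : 0 <= c < 2 * pi -> cos c = 1 -> c = 0.
  move=> /andP[c0 c2] c1; have pi0 := pi_ge0 R.
  have [cp|pc] := leP c pi.
    by apply: cos_inj; rewrite ?in_itv /= ?c0 ?lexx ?cos0.
  suff : 2 * pi - c = 0 by lra.
  apply: cos_inj; rewrite ?in_itv /= ?lexx ?cos0 //; first by apply/andP; split; lra.
  by have := per 1 (- c); rewrite mul1r addrC => ->; rewrite cosN.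
move=> a1; pose k := Num.floor (a / (2 * pi)).
have pi0 : 0 < 2 * pi :> R by rewrite mulr_gt0 ?pi_gt0.
exists k; rewrite subr0; apply/eqP; rewrite -subr_eq0; apply/eqP; apply: main.
  have /andP[h1 h2] := Num.Theory.floor_itv (a / (2 * pi)).
  rewrite ler_pdivlMr// -/k in h1; rewrite ltr_pdivrMr// intrD -/k in h2.
  by apply/andP; split; lra.
by have := per (- k) a; rewrite rmorphN mulNr a1.
Qed.

Lemma cos_sin_eq_angle a b : cos a = cos b -> sin a = sin b -> eq_angle (a - b) 0.
Proof.
by move=> ca sa; apply/eq_angle0_cos; rewrite cosB ca sa -!expr2 cos2Dsin2.
Qed.

Lemma cos_eq_angle a b : cos a = cos b -> eq_angle (a - b) 0 \/ eq_angle (a + b) 0.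
Proof.
move=> ca; have : sin a ^+ 2 = sin b ^+ 2 by rewrite !sin2cos2 ca.
move/eqP; rewrite eqf_sqr => /orP[] /eqP sa; [left|right].
  exact: cos_sin_eq_angle.
by rewrite -[b]opprK; apply: cos_sin_eq_angle; rewrite ?cosN ?sinN.
Qed.

Lemma cos_shift a b : eq_angle a 0 -> cos (a + b) = cos b.
Proof.
move=> /eq_angle0_cos a1; have /eqP : sin a ^+ 2 = 0 by rewrite sin2cos2 a1; ring.
by rewrite sqrf_eq0 cosD a1 => /eqP ->; rewrite mul1r mul0r subr0.
Qed.

Lemma cos_opp a b : eq_angle (a + b) 0 -> cos a = cos b.
Proof. by move=> ab; have := cos_shift (- b) ab; rewrite addrK cosN. Qed.

Lemma eq_angle0_pi : ~ eq_angle (pi : R) 0.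
Proof. by move=> /eq_angle0_cos; rewrite cospi; lra. Qed.

Lemma eq_angle0_double a : eq_angle (a *+ 2) 0 -> eq_angle a 0 \/ eq_angle (a - pi) 0.
Proof.
rewrite !eq_angle0_cos cos_mulr2n cosB cospi sinpi mulr0 addr0 mulrN1 => h.
have /eqP : cos a ^+ 2 = 1 by lra.
by rewrite sqrf_eq1 => /orP[] /eqP ->; [left|right; rewrite opprK].
Qed.

(** Subtracting [n./2] copies of [a *+ 2] from [a *+ n] leaves [a]. *)
Lemma eq_angle0_odd a n : odd n -> eq_angle (a *+ n) 0 -> eq_angle (a *+ 2) 0 ->
  eq_angle a 0.
Proof.
move=> on an /(@eq_angle0Mn _ n./2); rewrite -mulrnA => a2.
have -> : a = a *+ n - a *+ (2 * n./2).
  by rewrite -{1}(odd_double_half n) on -muln2 [(2 * _)%N]mulnC mulrnDr mulr1n addrK.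
exact: eq_angle0B.
Qed.

End Angles.

(** * Point configurations on the torus *)

Section Configuration.
Variables (R : realType) (n : nat) (m : 'I_n -> R) (alpha beta : 'I_n -> R).

Local Notation da i j := (alpha j - alpha i).
Local Notation db i j := (beta j - beta i).

(* For such pairs, and only for them, the distance of [q i] and [q j] depends
   on [r]. *)
Definition nonconst i j := cos (da i j) != cos (db i j).

Hypothesis hm : forall i, 0 < m i.
Hypothesis halpha : forall i j, eq_angle (da j i) 0 -> i = j.
Hypothesis hbeta : forall i j, eq_angle (db j i) 0 -> i = j.
Hypothesis no_antipodes : forall i j,
  ~ (cos (da i j) = -1 /\ cos (db i j) = -1).
Hypothesis sum_sin_alpha : forall i x y, x != y ->
  \sum_(k | (k != i) && same_gap (x, y)
       (cos (da i k), cos (db i k)))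
    m k * sin (da i k) = 0.
Hypothesis sum_sin_beta : forall i x y, x != y ->
  \sum_(k | (k != i) && same_gap (x, y)
       (cos (da i k), cos (db i k)))
    m k * sin (db i k) = 0.
Hypothesis sum_cos : forall i i' x y, x != y ->
  \sum_(k | (k != i) && same_gap (x, y)
       (cos (da i k), cos (db i k)))
    m k * (cos (da i k) - cos (db i k)) =
  \sum_(k | (k != i') && same_gap (x, y)
       (cos (da i' k), cos (db i' k)))
    m k * (cos (da i' k) - cos (db i' k)).

Lemma nonconst_sym i j : nonconst i j = nonconst j i.
Proof. by rewrite /nonconst -opprB cosN -(opprB (beta i)) cosN. Qed.

Lemma nonconst_neq i j : nonconst i j -> j != i.
Proof. by apply: contraNneq => ->; rewrite !subrr. Qed.

Lemma cos_alpha_neq1 i j : j != i -> cos (da i j) != 1.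
Proof. by apply: contraNneq => /eq_angle0_cos/halpha ->. Qed.

Lemma cos_beta_neq1 i j : j != i -> cos (db i j) != 1.
Proof. by apply: contraNneq => /eq_angle0_cos/hbeta ->. Qed.

Lemma eq_cos_sin_alpha i j k : cos (da i k) = cos (da i j) ->
  sin (da i k) = sin (da i j) -> k = j.
Proof.
move=> hc hs; apply: halpha; have := cos_sin_eq_angle hc hs.
by rewrite opprB subrKA.
Qed.

Lemma eq_cos_sin_beta i j k : cos (db i k) = cos (db i j) ->
  sin (db i k) = sin (db i j) -> k = j.
Proof.
move=> hc hs; apply: hbeta; have := cos_sin_eq_angle hc hs.
by rewrite opprB subrKA.
Qed.

(** Otherwise [k] differs from [j] by [pi] in both angles, against [no_antipodes]. *)
Lemma not_opposite i j k :
  ~ [/\ cos (da i k) = - cos (da i j),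
        sin (da i k) = - sin (da i j),
        cos (db i k) = - cos (db i j) &
        sin (db i k) = - sin (db i j)].
Proof.
case=> c1 s1 c2 s2; apply: (@no_antipodes j k).
have -> : da j k = da i k - da i j by ring.
have -> : db j k = db i k - db i j by ring.
by rewrite (cosB (da i k)) (cosB (db i k)) c1 s1 c2 s2 !mulNr -!opprD -!expr2 !cos2Dsin2.
Qed.

(** If [sin (da i j) = 0], then [da i j] is [pi] and [j] is alone in its class, so that
    [sum_sin_beta] reads [m j * sin (db i j) = 0]. Then both cosines are -1, against [nonconst i j].
    The other angle is symmetric. *)
Lemma sin_nonconst_neq0 i j : nonconst i j ->
  sin (da i j) != 0 /\ sin (db i j) != 0.
Proof.
move=> ij; have ji := nonconst_neq ij.
have sq a : sin a = 0 -> cos a = 1 \/ cos a = -1 :> R.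
  move=> s0; have := cos2Dsin2 a; rewrite s0 expr0n addr0 => /eqP.
  by rewrite sqrf_eq1 => /orP[] /eqP; [left|right].
have A1 k : k != i -> sin (da i k) = 0 -> cos (da i k) = -1.
  by move=> ki /sq[] // /eqP; rewrite (negbTE (cos_alpha_neq1 ki)).
have B1 k : k != i -> sin (db i k) = 0 -> cos (db i k) = -1.
  by move=> ki /sq[] // /eqP; rewrite (negbTE (cos_beta_neq1 ki)).
have N1 : (-1 : R) == 1 = false by apply/negbTE; rewrite lt_eqF //; lra.
have A2 : sin (da i j) = 0 -> sin (db i j) = 0.
  move=> s0; have := sum_sin_beta i ij; rewrite (bigD1 j) /=; last first.
    by rewrite ji /same_gap eqxx.
  rewrite big1 ?addr0 => [/eqP|k /andP[/andP[ki]]].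
    by rewrite mulf_eq0 gt_eqF //= => /eqP.
  rewrite /same_gap !xpair_eqE => /orP[]/andP[/eqP hc _]; rewrite (A1 j) // in hc.
    have sk : sin (da i k) = 0.
      apply/eqP; rewrite -sqrf_eq0; apply/eqP.
      by rewrite sin2cos2 hc; ring.
    by rewrite (@eq_cos_sin_alpha i j k) ?eqxx // ?hc ?sk ?s0 ?A1.
  by move: (cos_alpha_neq1 ki); rewrite hc /= opprK eqxx.
have B2 : sin (db i j) = 0 -> sin (da i j) = 0.
  move=> s0; have := sum_sin_alpha i ij; rewrite (bigD1 j) /=; last first.
    by rewrite ji /same_gap eqxx.
  rewrite big1 ?addr0 => [/eqP|k /andP[/andP[ki]]].
    by rewrite mulf_eq0 gt_eqF //= => /eqP.
  rewrite /same_gap !xpair_eqE => /orP[]/andP[_ /eqP hc]; rewrite (B1 j) // in hc.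
    have sk : sin (db i k) = 0.
      apply/eqP; rewrite -sqrf_eq0; apply/eqP.
      by rewrite sin2cos2 hc; ring.
    by rewrite (@eq_cos_sin_beta i j k) ?eqxx // ?hc ?sk ?s0 ?B1.
  by move: (cos_beta_neq1 ki); rewrite hc /= opprK eqxx.
split; apply: contraNneq ij => s0.
  by rewrite (A1 j) // (B1 j) // A2.
by rewrite (A1 j) ?B2 // (B1 j).
Qed.

(* In the sum of [sum_sin_alpha / sin (da i j) + sum_sin_beta / sin (db i j)],
   the coefficient of [m k] is 2 for [k = j], -2 for the mirror image of [j] in
   [i], and 0 for all other [k]: the remaining sign patterns are excluded by
   [no_antipodes]. *)
Lemma mirror i j : nonconst i j -> exists k,
  [/\ m k = m j, eq_angle (da i k + (da i j)) 0 &
      eq_angle (db i k + (db i j)) 0].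
Proof.
move=> ij; have ji := nonconst_neq ij; have [X0 Y0] := sin_nonconst_neq0 ij.
pose J k := (k != i) && same_gap (cos (da i j), cos (db i j))
  (cos (da i k), cos (db i k)).
pose T k := sin (da i k) / sin (da i j) +
  sin (db i k) / sin (db i j).
pose mir k := [/\ cos (da i k) = cos (da i j),
        sin (da i k) = - sin (da i j),
        cos (db i k) = cos (db i j) &
        sin (db i k) = - sin (db i j)].
have sumT : \sum_(k | J k) m k * T k = 0.
  rewrite (eq_bigr (fun k => m k * sin (da i k) / sin (da i j) +
     m k * sin (db i k) / sin (db i j))) => [|k _]; last first.
    by rewrite /T mulrDr !mulrA.
  by rewrite big_split -!mulr_suml /= sum_sin_alpha // sum_sin_beta // !mul0r addr0.
have Jj : J j by rewrite /J ji /same_gap eqxx.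
have Tj : T j = 2 by rewrite /T !divff.
have Tmir k : mir k -> T k = - 2.
  by case=> _ sa _ sb; rewrite /T sa sb !mulNr !divff // -opprD.
have Tcase k : J k -> [\/ k = j, mir k, T k = 0 |
    0 < T k /\ [/\ cos (da i k) = - cos (da i j), sin (da i k) = sin (da i j),
      cos (db i k) = - cos (db i j) & sin (db i k) = sin (db i j)]].
  move=> /andP[ki]; rewrite /same_gap /= !xpair_eqE => Jk.
  have [Sa Sb] : (sin (da i k) = sin (da i j) \/ sin (da i k) = - sin (da i j)) /\
      (sin (db i k) = sin (db i j) \/ sin (db i k) = - sin (db i j)).
    have sq a b : (cos a == cos b) || (cos a == - cos b) ->
        sin a = sin b \/ sin a = - sin b :> R.
      move=> h; have : sin a ^+ 2 == sin b ^+ 2.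
        by rewrite !sin2cos2; case/orP: h => /eqP ->; rewrite ?sqrrN.
      by rewrite eqf_sqr => /orP[]/eqP; [left|right].
    by split; apply: sq; case/orP: Jk => /andP[h1 h2]; rewrite ?h1 ?h2 ?orbT.
  case: Sa => sa; case: Sb => sb.
  - case/orP: Jk => /andP[/eqP ca /eqP cb].
      by constructor 1; exact: (@eq_cos_sin_alpha i).
    by constructor 4; split; first by rewrite /T sa sb !divff.
  - by constructor 3; rewrite /T sa sb mulNr !divff // subrr.
  - by constructor 3; rewrite /T sa sb mulNr !divff // addNr.
  - case/orP: Jk => /andP[/eqP ca /eqP cb].
      by constructor 2; split.
    by case: (@not_opposite i j k).
suff [k kmir] : exists k, mir k /\ m k = m j.
  case: kmir => -[ca sa cb sb] mk; exists k; split => //.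
    by apply/eq_angle0_cos; rewrite (cosD (da i k)) ca sa mulNr opprK -!expr2 cos2Dsin2.
  by apply/eq_angle0_cos; rewrite (cosD (db i k)) cb sb mulNr opprK -!expr2 cos2Dsin2.
(* The fourth alternative of [Tcase] is opposite to a mirror image, hence excluded once there is
   one. Without a mirror image all terms are nonnegative and that of [j] is positive. *)
have [[k kmir]|nomir] := pselect (exists k, mir k); last first.
  have : 0 < \sum_(k | J k) m k * T k.
    rewrite (bigD1 j) //= Tj ltr_wpDr ?mulr_gt0 //.
    apply: sumr_ge0 => k /andP[Jk kj]; apply: mulr_ge0; first exact: ltW.
    case: (Tcase k Jk) => [kj'|kmir|->|[/ltW]] //.
      by rewrite kj' eqxx in kj.
    by case: nomir; exists k.
  by rewrite sumT ltxx.
exists k; split => //.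
have [ca sa cb sb] := kmir.
have kj : k != j.
  apply/eqP => kj; move: sa X0; rewrite kj => /eqP.
  by rewrite -addr_eq0 -mulr2n mulrn_eq0 /= => ->.
have ki : k != i by apply: contraNneq ij => ki; rewrite /nonconst -ca -cb ki !subrr.
have Jk : J k by rewrite /J ki /same_gap ca cb eqxx.
move: sumT; rewrite (bigD1 j) //= (bigD1 k) /=; last by rewrite Jk.
rewrite big1 => [|l /andP[/andP[Jl lj] lk]].
  by rewrite Tj Tmir // addr0 => h; lra.
case: (Tcase l Jl) => [lj'|[ca' sa' cb' sb']|->|[_ [ca' sa' cb' sb']]].
- by rewrite lj' eqxx in lj.
- by rewrite (@eq_cos_sin_alpha i k l) ?eqxx // ?ca' ?sa' ?ca ?sa in lk.
- by rewrite mulr0.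
- by case: (@not_opposite i k l); rewrite ca sa cb sb !opprK.
Qed.

(** The mirror image of [i] in [j] continues the progression from [i] to [j]. *)
Lemma progression_step i j : nonconst i j -> exists k,
  [/\ nonconst j k, m k = m i, eq_angle (da j k - da i j) 0 &
      eq_angle (db j k - db i j) 0].
Proof.
move=> ij; have := ij; rewrite nonconst_sym => ji.
have [k [mk ka kb]] := mirror ji.
have ha : da j k - da i j = da j k + da j i by ring.
have hb : db j k - db i j = db j k + db j i by ring.
exists k; split; rewrite ?ha ?hb //; move: ij; rewrite /nonconst.
have -> : cos (da j k) = cos (da i j).
  by have := cos_shift (da i j) ka; congr (cos _ = _); ring.
have -> // : cos (db j k) = cos (db i j).
by have := cos_shift (db i j) kb; congr (cos _ = _); ring.
Qed.

Lemma progression i j : nonconst i j -> forall N : nat, exists k,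
  [/\ m k = if odd N then m j else m i, eq_angle (da i k - da i j *+ N) 0 &
      eq_angle (db i k - db i j *+ N) 0].
Proof.
move=> ij N.
(* The induction carries two consecutive points, since each step mirrors one in the other. *)
suff [k [l [_ mk ml [ka kb] [la lb]]]] : exists k l,
   [/\ nonconst k l, m k = (if odd N then m j else m i),
      m l = (if odd N then m i else m j),
      eq_angle (da i k - da i j *+ N) 0 /\ eq_angle (db i k - db i j *+ N) 0 &
      eq_angle (da k l - da i j) 0 /\ eq_angle (db k l - db i j) 0].
  by exists k; split.
elim: N => [|N [k [l [kl mk ml [ka kb] [la lb]]]]].
  by exists i, j; rewrite !mulr0n !subrr; split => //; split; exact: eq_angle00.
have [p [lp mp pa pb]] := progression_step kl.
exists l, p; split => //=; rewrite ?ml ?mp ?mk; try by case: odd.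
  split.
    have -> : da i l - da i j *+ N.+1 = (da i k - da i j *+ N) + (da k l - da i j).
      by rewrite mulrSr; ring.
    exact: eq_angle0D.
  have -> : db i l - db i j *+ N.+1 = (db i k - db i j *+ N) + (db k l - db i j).
    by rewrite mulrSr; ring.
  exact: eq_angle0D.
by split; [have := eq_angle0D pa la | have := eq_angle0D pb lb]; rewrite subrKA.
Qed.

(** The progression returns to [i], and it can be back in one angle only if it is back in both. As
    the masses alternate, a return after an odd number of steps also gives [m i = m j]. *)
Lemma nonconst_odd_order i j : nonconst i j -> m i = m j /\
  exists N, [/\ odd N, eq_angle (da i j *+ N) 0 & eq_angle (db i j *+ N) 0].
Proof.
move=> ij; have [f fP] := choice (progression ij).
have fi N : eq_angle (da i j *+ N) 0 -> f N = i.
  by move=> h; apply: halpha; have [_ fa _] := fP N; have := eq_angle0D fa h; rewrite subrK.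
have fi' N : eq_angle (db i j *+ N) 0 -> f N = i.
  by move=> h; apply: hbeta; have [_ _ fb] := fP N; have := eq_angle0D fb h; rewrite subrK.
have fa0 N : f N = i -> eq_angle (da i j *+ N) 0.
  by have [_ fa _] := fP N => h; have := eq_angle0N fa; rewrite h subrr sub0r opprK.
have fb0 N : f N = i -> eq_angle (db i j *+ N) 0.
  by have [_ _ fb] := fP N => h; have := eq_angle0N fb; rewrite h subrr sub0r opprK.
(* Pigeonhole: [n.+1] members of the progression among [n] points. *)
have exN : exists N, (0 < N)%N && (f N == i).
  have [inj|] := boolP (injectiveb (fun k : 'I_n.+1 => f k)).
    by have := leq_card _ (injectiveP _ inj); rewrite !card_ord ltnn.
  move=> /injectivePn[u [v uv fuv]].
  wlog ltuv : u v uv fuv / (u < v)%N.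
    move=> H; case: (ltngtP u v) => h; [exact: (H u v)| |].
      by apply: (H v u) => //; rewrite eq_sym.
    by rewrite (val_inj h) eqxx in uv.
  exists (v - u)%N; rewrite subn_gt0 ltuv /=; apply/eqP/fi.
  have [_ ua _] := fP u; have [_ va _] := fP v.
  have := eq_angle0B ua va; rewrite fuv.
  by rewrite mulrnBr ?(ltnW ltuv) //; congr (eq_angle _ 0); ring.
case: (ex_minnP exN) => N /andP[N0 /eqP fN] Nmin.
suff oN : odd N.
  split; first by have [] := fP N; rewrite fN oN.
  by exists N; split; [|exact: fa0|exact: fb0].
(* For even [N], half of the way is 0 or [pi] in each angle; 0 contradicts minimality, so [f N./2]
   is antipodal to [i]. *)
apply: contraT => eN; have NE := odd_double_half N; rewrite (negbTE eN) add0n in NE.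
have h0 : (0 < N./2)%N by rewrite half_gt0; case: (N) N0 eN => [|[]].
have fh : f N./2 <> i.
  move=> /eqP fh; have := Nmin N./2; rewrite h0 fh => /(_ isT).
  by rewrite -{1}NE -addnn -{3}[N./2]addn0 leq_add2l leqNgt h0.
have two (a : R) : eq_angle (a *+ N) 0 -> eq_angle (a *+ N./2) 0 \/ eq_angle (a *+ N./2 - pi) 0.
  by rewrite -{1}NE -muln2 mulrnA; exact: eq_angle0_double.
case: (two _ (fa0 _ fN)) => [/fi //|ha]; case: (two _ (fb0 _ fN)) => [/fi' //|hb].
case: (@no_antipodes i (f N./2)); have [_ ka kb] := fP N./2.
have pid (c d : R) : eq_angle (c - d) 0 -> eq_angle (d - pi) 0 -> cos c = -1 :> R.
  move=> h1 h2; have := cos_shift pi (eq_angle0D h1 h2).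
  by rewrite cospi => <-; congr cos; ring.
by split; [exact: pid ka ha|exact: pid kb hb].
Qed.

(* The coefficient in [sum_cos] does not vanish at [i], hence nowhere: no point
   contributes to it with the opposite sign, as both [a] and [a + pi] would
   then have odd order. *)
Lemma nonconst_everywhere i j l : nonconst i j -> exists k,
  k != l /\ cos (da l k) = cos (da i j) /\ cos (db l k) = cos (db i j).
Proof.
move=> ij; apply: contrapT => nol.
have Jpos p k : (k != p) && same_gap (cos (da i j), cos (db i j)) (cos (da p k), cos (db p k)) ->
    cos (da p k) = cos (da i j) /\ cos (db p k) = cos (db i j).
  move=> /andP[kp]; rewrite /same_gap /= !xpair_eqE => /orP[]/andP[/eqP ca /eqP cb] //.
  have pk : nonconst p k by rewrite /nonconst ca cb eqr_opp.
  have [_ [N [oN Na _]]] := nonconst_odd_order ij.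
  have [_ [M [oM Ma _]]] := nonconst_odd_order pk.
  have oNM : odd (M * N) by rewrite oddM oN oM.
  (* Both [M * N], which is odd, and 2 would annihilate [pi]. *)
  case: (@eq_angle0_pi R); apply: (eq_angle0_odd oNM); last first.
    by apply/eq_angle0_cos; rewrite cos2pi.
  have aM : eq_angle (da p k *+ (M * N)) 0 by rewrite mulrnA; exact: eq_angle0Mn.
  have aN : eq_angle (da i j *+ (M * N)) 0.
    by rewrite mulnC mulrnA; exact: eq_angle0Mn.
  have : cos (da p k) = cos (da i j + pi) by rewrite cosDpi.
  move=> /cos_eq_angle[] /(@eq_angle0Mn _ _ (M * N)) h.
    have -> : pi = da p k - da i j - (da p k - (da i j + pi)) by ring.
    by rewrite mulrnBl (mulrnBl _ (da p k)); do 2![apply: eq_angle0B => //].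
  have -> : pi = da p k + (da i j + pi) - (da p k + da i j) by ring.
  by rewrite mulrnBl (mulrnDl _ (da p k) (da i j)); apply: eq_angle0B => //; exact: eq_angle0D.
have := sum_cos i l ij; rewrite [RHS]big_pred0; last first.
  move=> k; apply/negP => Jk; apply: nol; exists k.
  by have [-> ->] := Jpos l k Jk; case/andP: Jk.
rewrite (eq_bigr (fun k => m k * (cos (da i j) - cos (db i j)))); last first.
  by move=> k /Jpos[-> ->].
rewrite -mulr_suml => /eqP; rewrite mulf_eq0 subr_eq0 (negbTE ij) orbF.
rewrite (bigD1 j) /= ?nonconst_neq ?/same_gap ?eqxx // gt_eqF //.
by rewrite ltr_wpDr // sumr_ge0 // => k _; exact: ltW.
Qed.

Definition translation_closed (a : 'I_n -> R) :=
  forall i j l, exists k, eq_angle (a k - a l - (a j - a i)) 0.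

(** Equal cosines fix a displacement from [l] up to sign; the mirror image in [l] supplies the other
    sign. *)
Lemma nonconst_translate i j l : nonconst i j ->
  (exists k, eq_angle (da l k - da i j) 0) /\ (exists k, eq_angle (db l k - db i j) 0).
Proof.
move=> ij; have [k [kl [ca cb]]] := nonconst_everywhere l ij.
have lk : nonconst l k by rewrite /nonconst ca cb.
have [k' [_ ka kb]] := mirror lk.
split.
  case: (cos_eq_angle ca) => h; first by exists k.
  by exists k'; have := eq_angle0B ka h; congr (eq_angle _ 0); ring.
case: (cos_eq_angle cb) => h; first by exists k.
by exists k'; have := eq_angle0B kb h; congr (eq_angle _ 0); ring.
Qed.

(* If [i], [k] and the mirror image [k'] of [k] in [i] are all in constant
   position to [j], then [2 (a + b)] or [2 (a - b)] vanishes, where [(a, b)] is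
   the difference of [k] and [i]; as it has odd order, [cos a = cos b]. *)
Lemma nonconst_connected i k j : nonconst i k ->
  nonconst i j \/ exists l, nonconst i l /\ nonconst l j.
Proof.
move=> ik; have [k' [_ ka kb]] := mirror ik.
have [|nij] := boolP (nonconst i j); [by left|right].
have [|nkj] := boolP (nonconst k j); first by exists k.
exists k'; split.
  by move: ik; rewrite /nonconst (cos_opp ka) (cos_opp kb).
apply: contraT => nk'j; move: nij nkj nk'j; rewrite /nonconst !negbK.
move=> /eqP cij /eqP ckj /eqP ck'j.
have [_ [N [oN Na Nb]]] := nonconst_odd_order ik.
have dbl (c : R) : c = da i k + db i k \/ c = da i k - db i k -> eq_angle (c *+ 2) 0 ->
    eq_angle c 0.
  move=> hc; apply: eq_angle0_odd oN _.
  case: hc => ->; first by rewrite mulrnDl; exact: eq_angle0D.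
  by rewrite mulrnBl; exact: eq_angle0B.
have absurd : ~ (eq_angle (da i k + db i k) 0 \/ eq_angle (da i k - db i k) 0).
  case=> h; move: ik; rewrite /nonconst; first by rewrite (cos_opp h) eqxx.
  by have := cos_shift (db i k) h; rewrite subrK => ->; rewrite eqxx.
case: absurd.
have := cos_eq_angle cij; have := cos_eq_angle ckj; have := cos_eq_angle ck'j.
pose e := da i j; pose f := db i j.
have -> : da k' j - db k' j = e + da i k - (f + db i k) -
    ((da i k' + da i k) - (db i k' + db i k))
  by rewrite /e /f; ring.
have -> : da k' j + db k' j = e + da i k + (f + db i k) -
    ((da i k' + da i k) + (db i k' + db i k))
  by rewrite /e /f; ring.
have -> : da k j - db k j = e - da i k - (f - db i k) by rewrite /e /f; ring.
have -> : da k j + db k j = e - da i k + (f - db i k) by rewrite /e /f; ring.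
rewrite -/e -/f.
have sh (c d : R) : eq_angle (c - d) 0 -> eq_angle d 0 -> eq_angle c 0.
  by move=> cd /(eq_angle0D cd); rewrite subrK.
(* Each equality of cosines comes with a sign. If that of [i] agrees with that of [k] or [k'],
   subtraction gives [a - b = 0] or [a + b = 0]; otherwise those of [k] and [k'] agree and give the
   double of such an equation. *)
move=> h1 h2 h3.
have {h1} : eq_angle (e + da i k - (f + db i k)) 0 \/ eq_angle (e + da i k + (f + db i k)) 0.
  by case: h1 => /sh h; [left|right]; apply: h; [exact: eq_angle0B|exact: eq_angle0D].
case: h3 => h3.
  case: h2 => h2; first by right; have := eq_angle0B h3 h2; congr (eq_angle _ 0); ring.
  case=> h1; first by right; have := eq_angle0B h1 h3; congr (eq_angle _ 0); ring.
  left; apply: dbl; first by left.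
  by have := eq_angle0B h1 h2; congr (eq_angle _ 0); ring.
case: h2 => h2; last by left; have := eq_angle0B h3 h2; congr (eq_angle _ 0); ring.
case=> h1; last by left; have := eq_angle0B h1 h3; congr (eq_angle _ 0); ring.
right; apply: dbl; first by right.
by have := eq_angle0B h1 h2; congr (eq_angle _ 0); ring.
Qed.

(** Every point has a nonconstant partner, so any two points are joined by at most two nonconstant
    steps; translations compose along them and masses agree. *)
Lemma translation_closed_of_nonconst i0 j0 : nonconst i0 j0 ->
  [/\ translation_closed alpha, translation_closed beta & forall i j, m i = m j].
Proof.
move=> ij0.
have conn i j : nonconst i j \/ exists l, nonconst i l /\ nonconst l j.
  have [k [ki [ca cb]]] := nonconst_everywhere i ij0.
  by apply: (@nonconst_connected i k); rewrite /nonconst ca cb.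
split=> [i j l|i j l|i j].
- case: (conn i j) => [/(nonconst_translate l)[]//|[p [ip pj]]].
  have [[k hk] _] := nonconst_translate l ip.
  have [[k' hk'] _] := nonconst_translate k pj.
  by exists k'; have := eq_angle0D hk hk'; congr (eq_angle _ 0); ring.
- case: (conn i j) => [/(nonconst_translate l)[]//|[p [ip pj]]].
  have [_ [k hk]] := nonconst_translate l ip.
  have [_ [k' hk']] := nonconst_translate k pj.
  by exists k'; have := eq_angle0D hk hk'; congr (eq_angle _ 0); ring.
- case: (conn i j) => [/nonconst_odd_order[]//|[p [ip pj]]].
  by rewrite (nonconst_odd_order ip).1 (nonconst_odd_order pj).1.
Qed.

End Configuration.

(** * Translation-closed sets of angles are regular polygons *)

Section RegularPolygon.
Variable R : realType.

Lemma sin_shift (a b : R) : eq_angle a 0 -> sin (a + b) = sin b.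
Proof. by move=> a0; rewrite -!cosBpihalf -addrA cos_shift. Qed.

Lemma unit_vec_eq_angle (a b : R) : eq_angle (a - b) 0 -> unit_vec a = unit_vec b.
Proof.
move=> ab; rewrite -(subrK b a); apply/rowP => k.
by rewrite !mxE cos_shift // sin_shift.
Qed.

Lemma eq_angle0_sum (J : finType) (F : J -> R) :
  (forall j, eq_angle (F j) 0) -> eq_angle (\sum_j F j) 0.
Proof.
move=> F0; apply: (big_ind (fun x : R => eq_angle x 0)) => //.
  exact: eq_angle00.
exact: eq_angle0D.
Qed.

(* Translation by [a j - a ord0] permutes the angles, hence does not change
   their sum modulo [2 pi]. *)
Lemma translation_closed_order n (a : 'I_n.+1 -> R) j :
  (forall i j, eq_angle (a i - a j) 0 -> i = j) -> translation_closed a ->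
  eq_angle ((a j - a ord0) *+ n.+1) 0.
Proof.
move=> a_inj ta; have [f fP] := choice (ta ord0 j).
have f_inj : injective f.
  move=> l l' fll; apply: a_inj; have := eq_angle0B (fP l') (fP l).
  by rewrite fll; congr (eq_angle _ 0); ring.
have := eq_angle0N (eq_angle0_sum fP).
have sf : \sum_l a (f l) = \sum_l a l by rewrite [RHS](reindex_inj f_inj).
by rewrite !sumrB sf subrr sub0r opprK !sumr_const card_ord mulrnBl.
Qed.

(** Differences of the angles are multiples of [2 * pi] over the number of points; being distinct,
    the angles exhaust the residues. *)
Lemma translation_closed_regular n (a : 'I_n -> R) (c w : R) : 0 < c ->
  (forall i j, eq_angle (a i - a j) 0 -> i = j) -> translation_closed a ->
  regular_polygon (fun i => c *: unit_vec (w + a i)).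
Proof.
case: n a => [|n] a c0 a_inj ta.
  by exists c, 0, 1%g; split => // -[].
have /choice[K KP] : forall j, exists k : int,
    a j = a ord0 + 2 * pi * k%:~R / n.+1%:R.
  move=> j; have [k] := translation_closed_order j a_inj ta.
  rewrite subr0 => h; exists k; rewrite [2 * pi * _]mulrC -h -(mulr_natr (a j - a ord0)) mulfK.
    by rewrite subrKC.
  by rewrite pnatr_eq0.
have rlt j : (`|(K j %% n.+1)%Z| < n.+1)%N.
  by rewrite -ltz_nat gez0_abs ?modz_ge0 // ltz_pmod.
pose rk j := Ordinal (rlt j).
have aE j : eq_angle (a j - (a ord0 + 2 * pi * (rk j)%:R / n.+1%:R)) 0.
  exists (K j %/ n.+1)%Z; rewrite subr0 KP.
  rewrite {1}(divz_eq (K j) n.+1) intrD intrM /= natr_absz ger0_norm ?modz_ge0 //.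
  by field; rewrite nat1r pnatr_eq0.
have rk_inj : injective rk.
  move=> i l ril; apply: a_inj; have := eq_angle0B (aE i) (aE l).
  by rewrite ril; congr (eq_angle _ 0); ring.
(* [rk] gives the cyclic position of a point, so its inverse lists the points in order. *)
exists c, (w + a ord0), (perm rk_inj)^-1%g; split => // k; congr (_ *: _).
apply: unit_vec_eq_angle; have := aE ((perm rk_inj)^-1%g k).
have -> : rk ((perm rk_inj)^-1%g k) = k by rewrite -(permE rk_inj) permKV.
by congr (eq_angle _ 0); ring.
Qed.

End RegularPolygon.

(** * Equations of motion *)

Section Rotopulsator.
Variables (R : realType) (n : nat) (m : 'I_n -> R) (I : set R).
Variables (q : 'I_n -> R -> 'rV[R]_4) (r rho theta phi : R -> R).
Variables (alpha beta : 'I_n -> R).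
Hypothesis hm : forall i, 0 < m i.
Hypothesis I_open : open I.
Hypothesis q_sol : curved_nbody_solution m I q.
Hypothesis r_rho : forall t, I t -> r t ^+ 2 + rho t ^+ 2 = 1.
Hypothesis q12 : forall t i, I t ->
  coords12 (q i t) = r t *: unit_vec (theta t + alpha i).
Hypothesis q34 : forall t i, I t ->
  coords34 (q i t) = rho t *: unit_vec (phi t + beta i).

Local Notation da i j := (alpha j - alpha i).
Local Notation db i j := (beta j - beta i).
Local Notation o0 := (@lshift 2 2 0).
Local Notation o1 := (@lshift 2 2 1).
Local Notation o2 := (@rshift 2 2 0).
Local Notation o3 := (@rshift 2 2 1).

Lemma dot4E (u v : 'rV[R]_4) :
  dot u v = u 0 o0 * v 0 o0 + u 0 o1 * v 0 o1 + (u 0 o2 * v 0 o2 + u 0 o3 * v 0 o3).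
Proof.
rewrite /dot (@big_split_ord _ _ _ 2 2) /= !big_ord_recl !big_ord0 !addr0.
by congr (_ * _ + _ * _ + (_ * _ + _ * _)); congr (_ _ _); apply: val_inj.
Qed.

Lemma q0E t i : I t -> q i t 0 o0 = r t * cos (theta t + alpha i).
Proof. by move=> It; have /rowP/(_ 0) := q12 i It; rewrite !mxE. Qed.

Lemma q1E t i : I t -> q i t 0 o1 = r t * sin (theta t + alpha i).
Proof. by move=> It; have /rowP/(_ 1) := q12 i It; rewrite !mxE. Qed.

Lemma q2E t i : I t -> q i t 0 o2 = rho t * cos (phi t + beta i).
Proof. by move=> It; have /rowP/(_ 0) := q34 i It; rewrite !mxE. Qed.

Lemma q3E t i : I t -> q i t 0 o3 = rho t * sin (phi t + beta i).
Proof. by move=> It; have /rowP/(_ 1) := q34 i It; rewrite !mxE. Qed.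

Lemma dot_qE t i j : I t ->
  dot (q i t) (q j t) = cos (db i j) + (cos (da i j) - cos (db i j)) * r t ^+ 2.
Proof.
move=> It; rewrite dot4E !q0E // !q1E // !q2E // !q3E //.
have -> : da i j = (theta t + alpha j) - (theta t + alpha i) by ring.
have -> : db i j = (phi t + beta j) - (phi t + beta i) by ring.
rewrite (cosB (theta t + alpha j)) (cosB (phi t + beta j)).
by rewrite -[X in _ = X + _]mul1r -(r_rho It); ring.
Qed.

Lemma gap_gt0 t i j : I t -> j != i ->
  0 < 1 - (cos (db i j) + (cos (da i j) - cos (db i j)) * r t ^+ 2) ^+ 2.
Proof.
move=> It ji; have [_ /(_ _ ji) + _ _ _] := q_sol It i.
rewrite dot_qE // => c1; rewrite subr_gt0 lt_neqAle c1 /=.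
have h1 := cos_le1 (da i j); have h2 := cos_geN1 (da i j).
have h3 := cos_le1 (db i j); have h4 := cos_geN1 (db i j).
have s0 := sqr_ge0 (r t); have s1 : 0 <= 1 - r t ^+ 2.
  by rewrite -(r_rho It) addrAC subrr add0r sqr_ge0.
set y := cos (db i j); set x := cos (da i j); set s := r t ^+ 2.
(* The inner product is a convex combination of [x] and [y]; the factors are 1 minus and 1 plus
   it. *)
have e : 1 - (y + (x - y) * s) ^+ 2 =
   ((1 - y) * (1 - s) + (1 - x) * s) * ((1 + y) * (1 - s) + (1 + x) * s) by ring.
by rewrite -subr_ge0 e mulr_ge0 // addr_ge0 // mulr_ge0 //; rewrite /x /y; lra.
Qed.

Lemma derive1_lincomb (f g : R -> 'rV[R]_4) (c1 c2 : R) (l l1 l2 : 'I_4) :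
  (forall t, I t -> derivable f t 1) -> (forall t, I t -> derivable g t 1) ->
  (forall t, I t -> f t 0 l = c1 * g t 0 l1 + c2 * g t 0 l2) ->
  forall t, I t -> derive1 f t 0 l = c1 * derive1 g t 0 l1 + c2 * derive1 g t 0 l2.
Proof.
move=> df dg fg t It.
rewrite !derive1E !derive_mx ?mxE; [|exact: dg|exact: df].
have dgl k : is_derive t 1 (fun x => g x 0 k) ('D_1 (fun x => g x 0 k) t).
  by split => //; exact: ((derivable_mxP g t 1).1 (dg t It)).
have h := is_deriveD (is_deriveZ c1 (dgl l1)) (is_deriveZ c2 (dgl l2)).
have e : \near t, (c1 *: (fun x => g x 0 l1) + c2 *: (fun x => g x 0 l2)) t = f t 0 l.
  near=> x; rewrite fg //; near: x; exact: open_nbhs_nbhs.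
by have [_ ->] := near_eq_is_derive e h.
Unshelve. all: by end_near. Qed.

(** A rotation in each coordinate plane takes [f i] to [f k]. Its coefficients are constant, so it
    can be differentiated without differentiating [r], [theta] or [phi]. *)
Definition rotated (f : 'I_n -> R -> 'rV[R]_4) i k t :=
  [/\ f k t 0 o0 = cos (da i k) * f i t 0 o0 + (- sin (da i k)) * f i t 0 o1,
      f k t 0 o1 = sin (da i k) * f i t 0 o0 + cos (da i k) * f i t 0 o1,
      f k t 0 o2 = cos (db i k) * f i t 0 o2 + (- sin (db i k)) * f i t 0 o3 &
      f k t 0 o3 = sin (db i k) * f i t 0 o2 + cos (db i k) * f i t 0 o3].

Lemma rotated_q t i k : I t -> rotated q i k t.
Proof.
move=> It; rewrite /rotated !q0E // !q1E // !q2E // !q3E //.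
have -> : theta t + alpha k = da i k + (theta t + alpha i) by ring.
have -> : phi t + beta k = db i k + (phi t + beta i) by ring.
split; rewrite ?(cosD (da i k)) ?(sinD (da i k)) ?(cosD (db i k)) ?(sinD (db i k)); ring.
Qed.

Lemma rotated_derive1 f i k : (forall j t, I t -> derivable (f j) t 1) ->
  (forall t, I t -> rotated f i k t) ->
  forall t, I t -> rotated (fun j => derive1 (f j)) i k t.
Proof.
move=> df fR t It.
split; (apply: derive1_lincomb It; [exact: df|exact: df|by move=> s /fR[]]).
Qed.

(** Plane rotations preserve determinants and inner products. *)
Lemma rotated_products f g i k t : rotated f i k t -> rotated g i k t ->
  [/\ f k t 0 o0 * g k t 0 o1 - f k t 0 o1 * g k t 0 o0 =
       f i t 0 o0 * g i t 0 o1 - f i t 0 o1 * g i t 0 o0,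
      f k t 0 o2 * g k t 0 o3 - f k t 0 o3 * g k t 0 o2 =
       f i t 0 o2 * g i t 0 o3 - f i t 0 o3 * g i t 0 o2,
      f k t 0 o0 * g k t 0 o0 + f k t 0 o1 * g k t 0 o1 =
       f i t 0 o0 * g i t 0 o0 + f i t 0 o1 * g i t 0 o1 &
      f k t 0 o2 * g k t 0 o2 + f k t 0 o3 * g k t 0 o3 =
       f i t 0 o2 * g i t 0 o2 + f i t 0 o3 * g i t 0 o3].
Proof.
move=> [-> -> -> ->] [-> -> -> ->].
split; rewrite -[RHS]mul1r.
- by rewrite -(cos2Dsin2 (da i k)); ring.
- by rewrite -(cos2Dsin2 (db i k)); ring.
- by rewrite -(cos2Dsin2 (da i k)); ring.
- by rewrite -(cos2Dsin2 (db i k)); ring.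
Qed.

(** * Sums obtained from the equations of motion *)

Local Notation weight t i j :=
  (m j / (1 - dot (q i t) (q j t) ^+ 2) `^ (3 / 2)).

Lemma acceleration_coord t i l : I t -> derive1n 2 (q i) t 0 l =
  \sum_(j | j != i) weight t i j * (q j t 0 l - dot (q i t) (q j t) * q i t 0 l) -
  dot (derive1 (q i) t) (derive1 (q i) t) * q i t 0 l.
Proof.
move=> It; have [_ _ _ _ ->] := q_sol It i.
rewrite !mxE summxE; congr (_ - _); apply: eq_bigr => j _.
by rewrite !mxE.
Qed.

(** All terms along [q i] cancel. *)
Lemma acceleration_cross t i l l' : I t ->
  q i t 0 l * derive1n 2 (q i) t 0 l' - q i t 0 l' * derive1n 2 (q i) t 0 l =
  \sum_(j | j != i) weight t i j * (q i t 0 l * q j t 0 l' - q i t 0 l' * q j t 0 l).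
Proof.
move=> It; rewrite !acceleration_coord //.
set K := dot (derive1 _ _) _.
transitivity (q i t 0 l * (\sum_(j | j != i)
       weight t i j * (q j t 0 l' - dot (q i t) (q j t) * q i t 0 l'))
   - q i t 0 l' * (\sum_(j | j != i) weight t i j * (q j t 0 l - dot (q i t) (q j t) * q i t 0 l))).
  ring.
by rewrite !mulr_sumr -sumrB; apply: eq_bigr => j _; ring.
Qed.

Lemma acceleration_inner t i l l' : I t ->
  q i t 0 l * derive1n 2 (q i) t 0 l + q i t 0 l' * derive1n 2 (q i) t 0 l' =
  \sum_(j | j != i) weight t i j * (q i t 0 l * q j t 0 l + q i t 0 l' * q j t 0 l'
     - dot (q i t) (q j t) * (q i t 0 l * q i t 0 l + q i t 0 l' * q i t 0 l'))
  - dot (derive1 (q i) t) (derive1 (q i) t) *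
      (q i t 0 l * q i t 0 l + q i t 0 l' * q i t 0 l').
Proof.
move=> It; rewrite !acceleration_coord //.
set K := dot (derive1 _ _) _.
transitivity (q i t 0 l * (\sum_(j | j != i)
       weight t i j * (q j t 0 l - dot (q i t) (q j t) * q i t 0 l))
   + q i t 0 l' * (\sum_(j | j != i) weight t i j * (q j t 0 l' - dot (q i t) (q j t) * q i t 0 l'))
   - K * (q i t 0 l * q i t 0 l + q i t 0 l' * q i t 0 l')).
  ring.
by rewrite !mulr_sumr -big_split /=; congr (_ - _); apply: eq_bigr => j _; ring.
Qed.

(* Summing the equal row sums with the weights [m i] gives an antisymmetric
   double sum. *)
Lemma row_sum_eq0 (A : 'I_n -> 'I_n -> R) i :
  (forall j k, A j k = - A k j) ->
  (forall j k, \sum_(l | l != j) m l * A j l = \sum_(l | l != k) m l * A k l) ->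
  \sum_(j | j != i) m j * A i j = 0.
Proof.
move=> antiA rowA; set S := LHS.
have dbl : (\sum_j m j) * S = \sum_j \sum_(k | k != j) m j * (m k * A j k).
  rewrite mulr_suml; apply: eq_bigr => j _.
  by rewrite -mulr_sumr; congr (_ * _); exact: rowA.
have : (\sum_j m j) * S = - ((\sum_j m j) * S).
  rewrite {1}dbl (exchange_big_dep predT) //= dbl -sumrN; apply: eq_bigr => j _.
  rewrite -sumrN; apply: eq_big => [k|k _]; first by rewrite eq_sym.
  by rewrite antiA; ring.
move=> h; have /eqP : (\sum_j m j) * S = 0 by lra.
rewrite mulf_eq0 => /orP[|/eqP //]; rewrite gt_eqF // (bigD1 i) //= ltr_wpDr //.
by rewrite sumr_ge0 // => j _; exact: ltW.
Qed.

Lemma velocity_dot_const t i k : I t ->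
  dot (derive1 (q k) t) (derive1 (q k) t) = dot (derive1 (q i) t) (derive1 (q i) t).
Proof.
move=> It.
have dq j s : I s -> derivable (q j) s 1 by move=> Is; have [] := q_sol Is j.
have vR := @rotated_derive1 q i k dq (fun s Is => rotated_q i k Is) t It.
have [_ _ e1 e2] := rotated_products vR vR.
by rewrite !dot4E; exact: (f_equal2 +%R e1 e2).
Qed.

Lemma rotated_acceleration t i k : I t -> rotated (fun j => derive1n 2 (q j)) i k t.
Proof.
have dq j s : I s -> derivable (q j) s 1 by move=> Is; have [] := q_sol Is j.
have ddq j s : I s -> derivable (derive1 (q j)) s 1 by move=> Is; have [] := q_sol Is j.
apply: (@rotated_derive1 (fun j => derive1 (q j))) => //.
by apply: rotated_derive1 => // s; exact: rotated_q.
Qed.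

Local Notation gap t i j :=
  ((1 - (cos (db i j) + (cos (da i j) - cos (db i j)) * r t ^+ 2) ^+ 2) `^ (- (3 / 2))).

Lemma weightE t i j : I t -> weight t i j = m j * gap t i j.
Proof. by move=> It; rewrite dot_qE // powRN. Qed.

Lemma gapC t i j : gap t i j = gap t j i.
Proof. by rewrite -(opprB (alpha i)) -(opprB (beta i)) !cosN. Qed.

(** Up to the factor [r t ^+ 2], the sum is the determinant of position and acceleration in the
    first plane, which is the same for all points; [row_sum_eq0] applies as the sine is odd. *)
Lemma sum_sin_alpha0 t i : I t -> r t != 0 ->
  \sum_(j | j != i) m j * (gap t i j * sin (da i j)) = 0.
Proof.
move=> It r0; apply: (row_sum_eq0 (A := fun i j => gap t i j * sin (da i j))).
  by move=> j k; rewrite gapC -(opprB (alpha j)) sinN mulrN.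
move=> j k; apply: (mulfI (expf_neq0 2 r0)).
have E p : r t ^+ 2 * (\sum_(l | l != p) m l * (gap t p l * sin (da p l))) =
   q p t 0 o0 * derive1n 2 (q p) t 0 o1 - q p t 0 o1 * derive1n 2 (q p) t 0 o0.
  rewrite acceleration_cross // mulr_sumr; apply: eq_bigr => l _.
  rewrite weightE // !q0E // !q1E //.
  have -> : da p l = (theta t + alpha l) - (theta t + alpha p) by ring.
  by rewrite (sinB (theta t + alpha l)); ring.
rewrite !E.
by have [] := rotated_products (rotated_q k j It) (rotated_acceleration k j It).
Qed.

Lemma sum_sin_beta0 t i : I t -> rho t != 0 ->
  \sum_(j | j != i) m j * (gap t i j * sin (db i j)) = 0.
Proof.
move=> It r0; apply: (row_sum_eq0 (A := fun i j => gap t i j * sin (db i j))).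
  by move=> j k; rewrite gapC -(opprB (beta j)) sinN mulrN.
move=> j k; apply: (mulfI (expf_neq0 2 r0)).
have E p : rho t ^+ 2 * (\sum_(l | l != p) m l * (gap t p l * sin (db p l))) =
   q p t 0 o2 * derive1n 2 (q p) t 0 o3 - q p t 0 o3 * derive1n 2 (q p) t 0 o2.
  rewrite acceleration_cross // mulr_sumr; apply: eq_bigr => l _.
  rewrite weightE // !q2E // !q3E //.
  have -> : db p l = (phi t + beta l) - (phi t + beta p) by ring.
  by rewrite (sinB (phi t + beta l)); ring.
rewrite !E.
by have [] := rotated_products (rotated_q k j It) (rotated_acceleration k j It).
Qed.

(** Up to the factor [r t ^+ 2 * rho t ^+ 2], each side is the inner product of position and
    acceleration in the first plane plus a multiple of the squared speed, both rotation
    invariant. *)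
Lemma sum_cos_const t i k : I t -> r t != 0 -> rho t != 0 ->
  \sum_(j | j != i) m j * (gap t i j * (cos (da i j) - cos (db i j))) =
  \sum_(j | j != k) m j * (gap t k j * (cos (da k j) - cos (db k j))).
Proof.
move=> It r0 rho0; apply: (mulfI (mulf_neq0 (expf_neq0 2 r0) (expf_neq0 2 rho0))).
have q2 p : q p t 0 o0 * q p t 0 o0 + q p t 0 o1 * q p t 0 o1 = r t ^+ 2.
  by rewrite q0E // q1E // -[RHS]mulr1 -(cos2Dsin2 (theta t + alpha p)); ring.
have E p : r t ^+ 2 * rho t ^+ 2 * (\sum_(l | l != p)
    m l * (gap t p l * (cos (da p l) - cos (db p l)))) =
   q p t 0 o0 * derive1n 2 (q p) t 0 o0 + q p t 0 o1 * derive1n 2 (q p) t 0 o1 +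
   dot (derive1 (q p) t) (derive1 (q p) t) * r t ^+ 2.
  rewrite acceleration_inner // q2 subrK mulr_sumr; apply: eq_bigr => l _.
  rewrite weightE // dot_qE //.
  have -> : rho t ^+ 2 = 1 - r t ^+ 2 by rewrite -(r_rho It) addrC addKr.
  have -> : q p t 0 o0 * q l t 0 o0 + q p t 0 o1 * q l t 0 o1 = r t ^+ 2 * cos (da p l).
    have -> : da p l = (theta t + alpha l) - (theta t + alpha p) by ring.
    by rewrite (cosB (theta t + alpha l)) !q0E // !q1E //; ring.
  ring.
apply: etrans (E i) _; apply: etrans _ (esym (E k)).
have [_ _ h _] := rotated_products (rotated_q k i It) (rotated_acceleration k i It).
exact: (f_equal2 +%R h (f_equal2 *%R (velocity_dot_const k i It) (erefl (r t ^+ 2)))).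
Qed.

(** The square of [r] is a polynomial in coordinates of [q i], hence continuous, and the
    intermediate value theorem applies. *)
Lemma sq_range (i : 'I_n) : is_interval I -> (forall t, I t -> 0 <= r t) ->
  ~ constant_on I r -> exists a b, a < b /\ forall s, a < s < b ->
    exists t, [/\ I t, r t ^+ 2 = s, r t != 0 & rho t != 0].
Proof.
move=> I_itv r0 rn.
have [[t1 [t2 [It1 It2 r12]]]|nor] :=
    pselect (exists t1 t2, [/\ I t1, I t2 & r t1 != r t2]); last first.
  case: rn; have [[t0 It0]|noI] := pselect (exists t, I t).
    exists (r t0) => t It; apply/eqP; apply: contrapT => /negP h.
    by apply: nor; exists t, t0.
  by exists 0 => t It; case: noI; exists t.
wlog t12 : t1 t2 It1 It2 r12 / t1 <= t2.
  move=> H; have [/H|/ltW /H] := leP t1 t2; first exact.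
  by apply => //; rewrite eq_sym.
pose f t := q i t 0 o0 * q i t 0 o0 + q i t 0 o1 * q i t 0 o1.
have fE t : I t -> f t = r t ^+ 2.
  move=> It; rewrite /f q0E // q1E // -[RHS]mulr1 -(cos2Dsin2 (theta t + alpha i)).
  ring.
have sub t : t \in `[t1, t2] -> I t.
  by rewrite in_itv /=; exact: I_itv.
have cf : {within `[t1, t2], continuous f}.
  apply: derivable_within_continuous => t /sub It.
  have [_ _ dq _ _] := q_sol It i.
  have dql l : derivable (fun x => q i x 0 l) t 1.
    exact: (derivable_mxP (q i) t 1).1 dq 0 l.
  by apply: derivableD; apply: derivableM.
exists (Num.min (f t1) (f t2)), (Num.max (f t1) (f t2)); split.
  have : f t1 != f t2.
    rewrite !fE // eqrXn2 // ?r0 //.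
  rewrite neq_lt => /orP[] lt12; first by rewrite min_l ?max_r ?ltW.
  by rewrite min_r ?max_l ?ltW.
move=> s /andP[s1 s2].
have [|t /sub It ft] := IVT t12 cf (v := s); first by rewrite !ltW.
exists t; have rs : r t ^+ 2 = s by rewrite -fE.
split => //.
  (* [r t = 0] and [rho t = 0] give the extreme values 0 and 1, which are not strictly between
     [f t1] and [f t2]. *)
  apply: contraTneq s1 => rt; rewrite -leNgt -rs rt expr0n /=.
  by rewrite le_min !fE // !sqr_ge0.
apply: contraTneq s2 => rt; rewrite -leNgt -rs.
have -> : r t ^+ 2 = 1 by rewrite -(r_rho It) rt expr0n /= addr0.
rewrite ge_max !fE //; apply/andP; split.
  by rewrite -(r_rho It1) lerDl sqr_ge0.
by rewrite -(r_rho It2) lerDl sqr_ge0.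
Qed.

(** Two indices let an equality between the sums of two points be split by classes; the sine sums
    take [c'] zero. *)
Lemma same_gap_sum_eq0 (c c' : 'I_n -> R) i i' x y a b : a < b ->
  (forall s, a < s < b -> exists t, [/\ I t, r t ^+ 2 = s, r t != 0 & rho t != 0]) ->
  x != y ->
  (forall t, I t -> r t != 0 -> rho t != 0 ->
    \sum_(j | j != i) c j * gap t i j + \sum_(j | j != i') c' j * gap t i' j = 0) ->
  \sum_(j | (j != i) && same_gap (x, y) (cos (da i j), cos (db i j))) c j +
  \sum_(j | (j != i') && same_gap (x, y) (cos (da i' j), cos (db i' j))) c' j = 0.
Proof.
move=> ab rt xy H.
pose L (c : 'I_n -> R) i := [seq (c j, (cos (da i j), cos (db i j))) |
  j <- index_enum 'I_n & j != i].
have := @sum_same_gap_eq0 R (L c i ++ L c' i') x y a b ab xy.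
rewrite big_cat !big_map !big_filter_cond /=; apply.
  move=> s /rt[t [It <- _ _]]; apply/allP => w.
  by rewrite mem_cat => /orP[] /mapP[j]; rewrite mem_filter => /andP[ji _] -> /=;
    exact: gap_gt0.
move=> s /rt[t [It <- rt0 rhot0]].
by rewrite big_cat !big_map !big_filter /=; exact: H.
Qed.

(** * Configurations on a great circle *)

Lemma dot_self_eq0 (v : 'rV[R]_4) : dot v v = 0 -> v = 0.
Proof.
move=> v0; apply/rowP => l; rewrite mxE; apply/eqP; rewrite -sqrf_eq0 expr2.
by apply/eqP; apply: (psumr_eq0P (P := predT) _ v0) => // k _; rewrite -expr2 sqr_ge0.
Qed.

(* The trigonometric identity [sin v U(u) = sin (v - u) U(0) + sin u U(v)]
   between unit vectors [U] holds between the [q i] as well, since in this case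
   their Gram matrix is the one of the vectors [unit_vec (alpha i)]. *)
Lemma gram_dependent t i0 i1 j : I t ->
  (forall k l, cos (da k l) = cos (db k l)) ->
  sin (da i0 i1) *: q j t =
    sin (da i0 i1 - da i0 j) *: q i0 t + sin (da i0 j) *: q i1 t.
Proof.
move=> It cab.
have dotE k l : dot (q k t) (q l t) = cos (da k l).
  by rewrite dot_qE // cab subrr mul0r addr0.
apply/eqP; rewrite -subr_eq0; apply/eqP; apply: dot_self_eq0.
set S := sin (da i0 i1); set p := sin (_ - _); set s := sin (da i0 j).
pose D k l := dot (q k t) (q l t).
have -> : dot (S *: q j t - (p *: q i0 t + s *: q i1 t))
              (S *: q j t - (p *: q i0 t + s *: q i1 t)) =
   S ^+ 2 * D j j + p ^+ 2 * D i0 i0 + s ^+ 2 * D i1 i1 -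
   S * p * D i0 j *+ 2 - S * s * D j i1 *+ 2 + p * s * D i0 i1 *+ 2.
  by rewrite /D !dot4E !mxE; ring.
rewrite /D !dotE !subrr cos0.
have -> : da j i1 = da i0 i1 - da i0 j by ring.
rewrite /p (cosB (da i0 i1)) (sinB (da i0 i1)) -/S -/s.
have eS := cos2Dsin2 (da i0 i1); have es := cos2Dsin2 (da i0 j).
rewrite -/S in eS; rewrite -/s in es.
move: (cos (da i0 i1)) (cos (da i0 j)) eS es => C c eS es.
transitivity (S ^+ 2 * (1 - (c ^+ 2 + s ^+ 2)) + s ^+ 2 * (1 - (C ^+ 2 + S ^+ 2))).
  ring.
by rewrite es eS; ring.
Qed.

Lemma span_great_circle (u v : 'rV[R]_4) : dot u u = 1 -> dot v v = 1 ->
  dot u v ^+ 2 != 1 -> \dim <<[:: u; v]>>%VS = 2.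
Proof.
move=> uu vv uv; have /eqP -> // : free [:: u; v].
rewrite free_cons seq1_free span_seq1; apply/andP; split; last first.
  apply: contraTneq (oner_neq0 R) => v0.
  by rewrite -vv v0 negbK /dot big1 // => l _; rewrite mxE mul0r.
apply: contra uv => /vlineP[k uE]; apply/eqP.
have k2 : dot (k *: v) (k *: v) = k ^+ 2 * dot v v.
  by rewrite !dot4E !mxE; ring.
have k1 : dot (k *: v) v = k * dot v v by rewrite !dot4E !mxE; ring.
by rewrite uE k1 vv mulr1 -[RHS]uu uE k2 vv mulr1.
Qed.

Lemma polygon_in_great_circle_of_const t (i0 i1 : 'I_n) : I t -> i1 != i0 ->
  (forall i j, cos (da i j) = cos (db i j)) ->
  polygon_in_great_circle (fun i => q i t).
Proof.
move=> It i10 cab.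
have sph i : dot (q i t) (q i t) = 1 by have [] := q_sol It i.
have dot1 i j : j != i -> dot (q i t) (q j t) ^+ 2 != 1.
  by move=> ji; have [_ /(_ _ ji)] := q_sol It i.
split.
  move=> i j qij; apply/eqP; rewrite eq_sym; apply: contraT => /dot1.
  by rewrite /= in qij; rewrite qij sph expr1n eqxx.
pose W := <<[:: q i0 t; q i1 t]>>%VS.
exists (@sphere3 R `&` [set x | x \in W]); split.
  by exists W; split => //; exact: span_great_circle (sph i0) (sph i1) (dot1 _ _ i10).
move=> j; split; first exact: sph.
(* The inner product of the two points is [cos (da i0 i1)], whose square is not 1. *)
have S0 : sin (da i0 i1) != 0.
  have := dot1 _ _ i10; rewrite dot_qE // cab subrr mul0r addr0.
  apply: contra_neq => s0; rewrite -cab; have := cos2Dsin2 (da i0 i1).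
  by rewrite s0 expr0n addr0.
have h := gram_dependent i0 i1 j It cab.
rewrite /= -[q j t]scale1r -(mulVf S0) -scalerA h memvZ //.
by rewrite memvD // memvZ // memv_span // !inE eqxx ?orbT.
Qed.

End Rotopulsator.

(* A circle has positive radius, so the polygon traced by (q_i1, q_i2) is only
   considered at times where r is nonzero, and similarly for rho. *)
Theorem theorem1p5 (R : realType) (n : nat) (m : 'I_n -> R)
    (hm : forall i, 0 < m i)
    (I : set R) (I_open : open I) (I_itv : is_interval I)
    (q : 'I_n -> R -> 'rV[R]_4) (ri rhoi : 'I_n -> R -> R)
    (theta phi : R -> R) (alpha beta : 'I_n -> R)
    (hq : positive_elliptic_elliptic m I q ri rhoi theta phi alpha beta)
    (r rho : R -> R)
    (hr : forall i t, I t -> ri i t = r t)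
    (hrho : forall i t, I t -> rhoi i t = rho t)
    (r_nonconstant : ~ constant_on I r)
    (rho_nonconstant : ~ constant_on I rho)
    (halpha : distinct_angles alpha)
    (hbeta : distinct_angles beta) :
  ((forall t, I t ->
      (r t != 0 -> regular_polygon (fun i => coords12 (q i t))) /\
      (rho t != 0 -> regular_polygon (fun i => coords34 (q i t)))) /\
   (forall i j, m i = m j))
  \/
  (forall t, I t -> polygon_in_great_circle (fun i => q i t)).
Proof.
case: hq => q_sol hcoord.
have q12 t i : I t -> coords12 (q i t) = r t *: unit_vec (theta t + alpha i).
  by move=> It; have [_ _ _] := hcoord _ It i; rewrite hr.
have q34 t i : I t -> coords34 (q i t) = rho t *: unit_vec (phi t + beta i).
  by move=> It; have [_ _ _ _] := hcoord _ It i; rewrite hrho.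
have a_inj i j : eq_angle (alpha i - alpha j) 0 -> i = j.
  by rewrite -eq_angle_subP; exact: halpha.
have b_inj i j : eq_angle (beta i - beta j) 0 -> i = j.
  by rewrite -eq_angle_subP; exact: hbeta.
have regular : translation_closed alpha -> translation_closed beta ->
    (forall i j, m i = m j) ->
    (forall t, I t ->
      (r t != 0 -> regular_polygon (fun i => coords12 (q i t))) /\
      (rho t != 0 -> regular_polygon (fun i => coords34 (q i t)))) /\
   (forall i j, m i = m j).
  move=> ca cb mE; split => // t It.
  have ge0 (i : 'I_n) : 0 <= r t /\ 0 <= rho t.
    by have [] := hcoord _ It i; rewrite hr // hrho.
  split=> n0.
    (* The sign of [r t] is known only through an index [i]; the absolute value covers [n = 0]. *)
    have -> : (fun i => coords12 (q i t)) =
        (fun i => `|r t| *: unit_vec (theta t + alpha i)).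
      by apply/funext => i; rewrite q12 // ger0_norm //; case: (ge0 i).
    by apply: translation_closed_regular; rewrite ?normr_gt0.
  have -> : (fun i => coords34 (q i t)) =
      (fun i => `|rho t| *: unit_vec (phi t + beta i)).
    by apply/funext => i; rewrite q34 // ger0_norm //; case: (ge0 i).
  by apply: translation_closed_regular; rewrite ?normr_gt0.
have [[i1 [i0 i10]]|trivial_I] := pselect (exists i1 i0 : 'I_n, i1 != i0); last first.
  have all_eq (i j : 'I_n) : i = j.
    by apply/eqP; apply: contrapT => /negP ij; apply: trivial_I; exists i, j.
  left; apply: regular => [i j l|i j l|i j]; last by rewrite (all_eq i j).
    by exists l; rewrite (all_eq j i) !subrr; exact: eq_angle00.
  by exists l; rewrite (all_eq j i) !subrr; exact: eq_angle00.
have r_rho t : I t -> r t ^+ 2 + rho t ^+ 2 = 1.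
  by move=> It; have [_ _ + _ _] := hcoord _ It i0; rewrite hr // hrho.
have r_ge0 t : I t -> 0 <= r t.
  by move=> It; have [+ _ _ _ _] := hcoord _ It i0; rewrite hr.
have [cab|] := pselect (forall i j, cos (alpha j - alpha i) = cos (beta j - beta i)).
  by right => t It; exact: (polygon_in_great_circle_of_const q_sol r_rho q12 q34 It i10).
move=> /existsNP[i /existsNP[j /eqP ij]]; left.
have [a [b [ab rt]]] := sq_range q_sol r_rho q12 i0 I_itv r_ge0 r_nonconstant.
have m1 : a < (a + b) / 2 < b by apply/andP; split; lra.
have [t0 [It0 _ _ _]] := rt _ m1.
have [] // := @translation_closed_of_nonconst R n m alpha beta hm a_inj b_inj _ _ _ _ i j ij.
(* Antipodal points would have inner product -1, against [gap_gt0]. *)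
- move=> k l [ca cb]; have [lk|lk] := eqVneq l k.
    by move: ca; rewrite lk subrr cos0; lra.
  have := gap_gt0 q_sol r_rho q12 q34 It0 lk.
  by rewrite ca cb subrr mul0r addr0 sqrrN expr1n subrr ltxx.
- move=> k x y xy; have := @same_gap_sum_eq0 _ _ _ _ _ _ _ _ _ _ _ q_sol r_rho q12 q34
    (fun l => m l * sin (alpha l - alpha k)) (fun=> 0) k k x y a b ab rt xy.
  rewrite [X in _ + X]big1 ?addr0 //; apply=> t It rt0 rhot0.
  rewrite [X in _ + X]big1 ?addr0 => [|l _]; last by rewrite mul0r.
  rewrite -[RHS](sum_sin_alpha0 hm I_open q_sol r_rho q12 q34 k It rt0).
  by apply: eq_bigr => l _; rewrite mulrAC mulrA.
- move=> k x y xy; have := @same_gap_sum_eq0 _ _ _ _ _ _ _ _ _ _ _ q_sol r_rho q12 q34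
    (fun l => m l * sin (beta l - beta k)) (fun=> 0) k k x y a b ab rt xy.
  rewrite [X in _ + X]big1 ?addr0 //; apply=> t It rt0 rhot0.
  rewrite [X in _ + X]big1 ?addr0 => [|l _]; last by rewrite mul0r.
  rewrite -[RHS](sum_sin_beta0 hm I_open q_sol r_rho q12 q34 k It rhot0).
  by apply: eq_bigr => l _; rewrite mulrAC mulrA.
move=> k k' x y xy; apply/eqP; rewrite -subr_eq0 -sumrN; apply/eqP.
pose c k l := m l * (cos (alpha l - alpha k) - cos (beta l - beta k)).
apply: (@same_gap_sum_eq0 _ _ _ _ _ _ _ _ _ _ _ q_sol r_rho q12 q34
  (c k) (fun l => - c k' l) k k' x y a b ab rt xy) => t It rt0 rhot0.
have := sum_cos_const I_open q_sol r_rho q12 q34 k k' It rt0 rhot0.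
move=> /eqP; rewrite -subr_eq0 -sumrN => /eqP h; rewrite -[RHS]h.
by congr (_ + _); apply: eq_bigr => l _; rewrite /c ?mulNr mulrAC mulrA.
Qed.
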